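(* Let $\varepsilon\in(0,1]$ and run the Guarded Ball Cover algorithm (described in the context) on a stream $S$ of points in $\mathbb{R}^d$. At any time, $\mathcal{B}$ contains $\mathcal{O}(\varepsilon^{-2}\log(1/\varepsilon))$ triples, and every point of $S$ that has arrived so far lies in $\bigcup_{(c,r,q)\in\mathcal{B}} B(c,(1+\varepsilon)r)$.
   Context: Notation: $\lVert pq\rVert$ is the Euclidean distance; $B(c,r)$ is the closed ball with center $c$ and radius $r$; its $(1+\varepsilon)$-expansion is $B(c,(1+\varepsilon)r)$; $\mathrm{MEB}(X)$ is the minimum enclosing ball of a finite set $X$. Guarded Ball Cover algorithm with parameter $\varepsilon\in(0,1]$: the points of a multiset $S\subset\mathbb{R}^d$ arrive one at a time. It maintains a collection $\mathcal{B}$ of triples $(c,r,q)$ (center $c\in\mathbb{R}^d$, radius $r\ge 0$, guard $q\in S$), each identified with the ball $B(c,r)$, and a set $Q$ of stored points. Let $p_1$ be the first point of the stream; initially $\mathcal{B}=\emptyset$ and $Q=\{p_1\}$. Each subsequent point $p$ is processed as follows: if $p\notin\bigcup_{(c,r,q)\in\mathcal{B}}B(c,(1+\varepsilon)r)$, then (i) compute the exact minimum enclosing ball $B(c,r)=\mathrm{MEB}(Q\cup\{p\})$; (ii) replace $\mathcal{B}$ by $\{(c,r,p)\}\cup\{(c',r',q')\in\mathcal{B}: r'\ge \varepsilon^2 r/80\}$ (the removed triples are said to be deleted); (iii) set $Q=\{p_1\}\cup\{q:(c'',r'',q)\in\mathcal{B}\}$. Otherwise $p$ is discarded.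
   Formalization: Coverage is claimed only once a point after the first has arrived (before that the collection of triples is empty), and log(1/ε) in the size bound is read as max(1, ln(1/ε)), since the literal bound vanishes at ε = 1. *)

(* Defs.v *)
From mathcomp Require Import all_boot all_order all_algebra.
From mathcomp Require Import boolp classical_sets reals.

Set Implicit Arguments.
Unset Strict Implicit.
Unset Printing Implicit Defensive.

Import Order.TTheory GRing.Theory Num.Theory.

Local Open Scope ring_scope.

(* The library norm on 'rV[R]_d is the sup norm, hence an explicit Euclidean
   distance. *)
Definition edist (R : realType) (d : nat) (x y : 'rV[R]_d) : R :=
  Num.sqrt (\sum_(i < d) (x 0 i - y 0 i) ^+ 2).

Definition in_ball (R : realType) (d : nat) (c : 'rV[R]_d) (r : R) :
  pred 'rV[R]_d := fun x => edist x c <= r.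

Definition encloses (R : realType) (d : nat) (X : seq 'rV[R]_d)
    (b : 'rV[R]_d * R) : bool :=
  all (in_ball b.1 b.2) X.

Definition is_MEB (R : realType) (d : nat) (X : seq 'rV[R]_d)
    (b : 'rV[R]_d * R) : Prop :=
  [/\ 0 <= b.2, encloses X b &
      forall b' : 'rV[R]_d * R, 0 <= b'.2 -> encloses X b' -> b.2 <= b'.2].

(* A finite nonempty X has exactly one minimum enclosing ball; the default
   value (0, 0) of xget only matters for X = [::], where MEB is never used. *)
Definition MEB (R : realType) (d : nat) (X : seq 'rV[R]_d) : 'rV[R]_d * R :=
  xget (0, 0) [set b | is_MEB X b]%classic.

Definition triple (R : realType) (d : nat) : Type :=
  ('rV[R]_d * R * 'rV[R]_d)%type.

Definition center (R : realType) (d : nat) (t : triple R d) : 'rV[R]_d :=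
  t.1.1.
Definition radius (R : realType) (d : nat) (t : triple R d) : R := t.1.2.
Definition guard (R : realType) (d : nat) (t : triple R d) : 'rV[R]_d := t.2.

Definition in_expansion (R : realType) (d : nat) (eps : R) (t : triple R d) :
  pred 'rV[R]_d := in_ball (center t) ((1 + eps) * radius t).

Definition covered (R : realType) (d : nat) (eps : R) (B : seq (triple R d))
    (p : 'rV[R]_d) : bool :=
  has (fun t => in_expansion eps t p) B.

(* The collection of triples together with the stored points. Both are lists,
   so that the size of the former counts repetitions and bounds from above the
   number of distinct triples. *)
Definition gbc_state (R : realType) (d : nat) : Type :=
  (seq (triple R d) * seq 'rV[R]_d)%type.

Definition gbc_init (R : realType) (d : nat) (p1 : 'rV[R]_d) :
  gbc_state R d := ([::], [:: p1]).

Definition gbc_step (R : realType) (d : nat) (eps : R) (p1 : 'rV[R]_d)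
    (st : gbc_state R d) (p : 'rV[R]_d) : gbc_state R d :=
  let: (B, Q) := st in
  if covered eps B p then st
  else
    let: (c, r) := MEB (rcons Q p) in
    let B' := (c, r, p) :: [seq t <- B | eps ^+ 2 * r / 80 <= radius t] in
    (B', p1 :: [seq guard t | t <- B']).

(* State after the stream p1 :: s has arrived. *)
Definition gbc_run (R : realType) (d : nat) (eps : R) (p1 : 'rV[R]_d)
    (s : seq 'rV[R]_d) : gbc_state R d :=
  foldl (gbc_step eps p1) (gbc_init p1) s.

Definition gbc_triples (R : realType) (d : nat) (eps : R) (p1 : 'rV[R]_d)
    (s : seq 'rV[R]_d) : seq (triple R d) :=
  (gbc_run eps p1 s).1.

(* Main.v *)
(* Let B(c,r) be the latest ball, the minimum enclosing ball of X. A triple of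
   radius rho is deleted only if rho < eps^2 r / 80; its ball contains both its
   guard and p1, so every point of X that is no longer stored is within
   eps^2 r / 40 of p1. If p escapes B(c,(1+eps)r), the next ball B(c',r')
   contains p and the stored points, hence all of X after an expansion by
   eps^2 r / 40, so r^2 + |cc'|^2 <= (r' + eps^2 r / 40)^2. As moreover
   (1+eps) r < r' + |cc'|, this forces r' > (1 + eps^2/16) r. The radii thus
   grow geometrically while staying within a factor 80 / eps^2 of each other,
   which bounds their number. Coverage survives deletions because everything
   covered by a triple deleted on the arrival of a ball of radius r is within
   3 eps^2 r / 80 of p1. *)
From mathcomp Require Import ring lra.
From mathcomp Require Import boolp classical_sets topology normedtype derive.
From mathcomp Require Import realfun.
(* After the analysis library, which has another [edist]. *)
Require Import Defs.
From mathcomp Require Import all_boot all_order all_algebra.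
From mathcomp Require Import reals exp.

Import Order.TTheory GRing.Theory Num.Theory.
Import numFieldNormedType.Exports.
Local Open Scope ring_scope.

(** * Euclidean distance and minimum enclosing balls *)

Section Euclidean.
Set Implicit Arguments.
Unset Strict Implicit.
Context {R : realType} {d : nat}.
Implicit Types (x y z c : 'rV[R]_d) (r : R) (X : seq 'rV[R]_d).

Lemma edist_ge0 x y : 0 <= edist x y.
Proof. exact: sqrtr_ge0. Qed.

Lemma sqr_edist x y : edist x y ^+ 2 = \sum_(i < d) (x 0 i - y 0 i) ^+ 2.
Proof. by rewrite sqr_sqrtr// sumr_ge0// => i _; exact: sqr_ge0. Qed.

Lemma edistC x y : edist x y = edist y x.
Proof. by congr Num.sqrt; apply: eq_bigr => i _; ring. Qed.

Lemma norm_coord_le_edist x y i : `|x 0 i - y 0 i| <= edist x y.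
Proof.
rewrite -ler_sqr ?nnegrE ?edist_ge0// sqr_edist real_normK ?num_real//.
rewrite (bigD1 i)//= lerDl sumr_ge0// => j _; exact: sqr_ge0.
Qed.

Lemma edist_eq0 x y : edist x y = 0 -> x = y.
Proof.
move=> xy0; apply/rowP => i; apply/eqP; rewrite -subr_eq0 -normr_le0 -xy0.
exact: norm_coord_le_edist.
Qed.

Lemma edist_triangle y x z : edist x z <= edist x y + edist y z.
Proof.
have [a0|] := eqVneq (edist x y) 0; first by rewrite a0 (edist_eq0 a0) add0r.
have [b0|] := eqVneq (edist y z) 0.
  by rewrite b0 (edist_eq0 b0) addr0.
rewrite !neq_lt !ltNge !edist_ge0/= -!ltNge.
set a := edist x y; set b := edist y z => b0 a0.
rewrite -ler_sqr ?nnegrE ?edist_ge0 ?addr_ge0 ?edist_ge0//.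
(* With these weights the claim follows coordinate by coordinate from Young's inequality, whose gap
   is a square divided by [a * b]. *)
have -> : (a + b) ^+ 2 = (1 + b / a) * a ^+ 2 + (1 + a / b) * b ^+ 2.
  by field; rewrite !gt_eqF.
rewrite !sqr_edist !mulr_sumr -big_split/=; apply: ler_sum => i _.
set u := x 0 i; set v := y 0 i; set w := z 0 i.
rewrite -subr_ge0.
have -> : (1 + b / a) * (u - v) ^+ 2 + (1 + a / b) * (v - w) ^+ 2
  - (u - w) ^+ 2 = (b * (u - v) - a * (v - w)) ^+ 2 / (a * b).
  by field; rewrite !gt_eqF.
by rewrite divr_ge0 ?sqr_ge0 ?mulr_ge0 ?ltW.
Qed.

Lemma continuous_edist x : continuous (edist x).
Proof.
move=> c; rewrite /edist; apply: continuous_comp; last exact: sqrt_continuous.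
apply: (@continuous_big R 'I_d (fun a b : R => a + b)) => [|i _].
  by move=> ab; exact: add_continuous.
move=> v; apply: (@continuous_comp _ R R (fun v : 'rV[R]_d => x 0 i - v 0 i)
  (fun a : R => a ^+ 2)); last exact: exprn_continuous.
apply: (@continuous_comp _ R R (fun v : 'rV[R]_d => v 0 i)
  (fun a : R => x 0 i - a)); first exact: coord_continuous.
by apply: continuousB; [exact: cst_continuous|exact: cvg_id].
Qed.

(** The largest distance [f] from a center to [X] is continuous, so it attains a minimum on the box
    of half-width [f x0] around [x0]. A center outside the box is farther than [f x0] from [x0],
    hence no better than [x0] itself. *)
Lemma MEB_exists X : X != [::] -> exists b, is_MEB X b.
Proof.
case: X => // x0 X _; set Y := x0 :: X.
pose f c := \big[Num.max/0]_(x <- Y) edist x c.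
have fP c r : 0 <= r -> encloses Y (c, r) = (f c <= r).
  move=> r0; apply/idP/idP => [/allP Yc|fr].
    rewrite /f big_seq; apply: bigmax_le => // x; exact: Yc.
  apply/allP => x xY; apply: le_trans fr; rewrite /f/=.
  exact: (@le_bigmax_seq _ _ _ Y 0 x predT (fun y => edist y c)).
have f0 c : 0 <= f c by exact: bigmax_ge_id.
have cf : continuous f.
  move=> c; apply: (@continuous_big R 'rV[R]_d Num.max) => [|x _].
    by move=> ab; apply: continuous_max; [exact: cvg_fst|exact: cvg_snd].
  exact: continuous_edist.
pose I i := `[x0 0 i - f x0, x0 0 i + f x0]%classic.
have cI : compact [set v : 'rV[R]_d | forall i, I i (v ord0 i)].
  by apply: (@rV_compact R d I) => i; apply: segment_compact.
have x0I : [set v : 'rV[R]_d | forall i, I i (v ord0 i)]%classic x0.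
  by move=> i; rewrite /I/= in_itv/=; have := f0 x0; lra.
have [||c _ cmin] := EVT_min_rV _ cI (f := f).
- by exists x0.
- exact: continuous_subspaceT.
exists (c, f c); split => [||[c' r'] r'0]; rewrite ?fP//=; apply: le_trans.
have [/cmin//|] := boolP (c' \in
  [set v : 'rV[R]_d | forall i, I i (v ord0 i)]%classic).
rewrite notin_setE/= => /existsNP[i c'i].
apply: le_trans (_ : f x0 <= _); first exact/cmin/mem_set.
apply: le_trans (_ : edist x0 c' <= _); last first.
  rewrite /f; apply: (@le_bigmax_seq _ _ _ Y 0 x0 predT (fun y => edist y c'));
    by rewrite ?mem_head.
apply: le_trans (norm_coord_le_edist _ _ i).
rewrite leNgt; apply/negP => h; apply: c'i.
by rewrite /I/= in_itv/=; move: h; rewrite ltr_norml; lra.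
Qed.

Lemma MEBP X : X != [::] -> is_MEB X (MEB X).
Proof.
by move=> /MEB_exists /(@xgetPex _ (0, 0) [set b | is_MEB X b]%classic).
Qed.

(* Moving the center slightly from [c] towards [c'] may not shrink the ball. *)
Lemma MEB_sqr_radius_le X c r c' r' : X != [::] -> is_MEB X (c, r) ->
  0 <= r' -> encloses X (c', r') -> r ^+ 2 + edist c c' ^+ 2 <= r' ^+ 2.
Proof.
move=> X0 [/= r0 /allP Xc cmin] r'0 /allP Xc'.
set D := edist c c'.
have key t : 0 < t -> t <= 1 -> r ^+ 2 + D ^+ 2 <= r' ^+ 2 + t * D ^+ 2.
  move=> t0 t1.
  pose ct : 'rV[R]_d := (1 - t) *: c + t *: c'.
  pose S := (1 - t) * r ^+ 2 + t * r' ^+ 2 - t * (1 - t) * D ^+ 2.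
  (* Stewart's theorem for the point [ct] of the segment from [c] to [c']. *)
  have dist x : edist x ct ^+ 2 = (1 - t) * edist x c ^+ 2
      + t * edist x c' ^+ 2 - t * (1 - t) * D ^+ 2.
    rewrite !sqr_edist !mulr_sumr -big_split/= -sumrB; apply: eq_bigr => i _.
    by rewrite !mxE; ring.
  have XS x : x \in X -> edist x ct ^+ 2 <= S.
    move=> xX; rewrite dist lerD2r.
    have := Xc _ xX; have := Xc' _ xX; rewrite /in_ball/= => h' h.
    by apply: lerD; rewrite ler_wpM2l ?subr_ge0 ?(ltW t0)// lerXn2r
      ?nnegrE ?edist_ge0.
  have S0 : 0 <= S.
    case: X X0 XS {Xc cmin Xc'} => // x X _ XS.
    by apply: le_trans (XS x _); rewrite ?mem_head ?sqr_ge0.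
  have rS : r <= Num.sqrt S.
    apply: (cmin (ct, Num.sqrt S)); rewrite /= ?sqrtr_ge0//.
    apply/allP => x xX; rewrite /in_ball/=.
    by rewrite -ler_sqr ?nnegrE ?edist_ge0 ?sqrtr_ge0// (sqr_sqrtr S0) XS.
  move: rS; rewrite -ler_sqr ?nnegrE ?sqrtr_ge0// sqr_sqrtr//.
  rewrite -subr_ge0 => rS; rewrite -subr_ge0 -(pmulr_rge0 _ t0).
  by move: rS; congr (0 <= _); rewrite /S; ring.
have [D0|D0] := eqVneq D 0; first by have := key 1; rewrite D0; lra.
rewrite leNgt; apply/negP => h.
have D2 : 0 < D ^+ 2 by rewrite exprn_gt0// lt0r D0 edist_ge0.
(* [key] is the goal up to the error [t * D ^+ 2]; [t = u] makes this error half of the assumed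
   violation. If [u > 1], then [key 1] already gives the contradiction. *)
pose u := (r ^+ 2 + D ^+ 2 - r' ^+ 2) / (2 * D ^+ 2).
have u0 : 0 < u by apply: divr_gt0; lra.
have uD : u * D ^+ 2 = (r ^+ 2 + D ^+ 2 - r' ^+ 2) / 2.
  by rewrite /u; field.
have [u1|u1] := leP u 1; first by have := key u u0 u1; rewrite uD; lra.
have := key 1 ltr01 (lexx _); have : D ^+ 2 < u * D ^+ 2 by rewrite ltr_pMl.
rewrite uD; have := sqr_ge0 r; have := sqr_ge0 r'; lra.
Qed.

Lemma MEB_radius_growth eps X c r c' r' q p : 0 < eps -> eps <= 1 ->
  X != [::] -> is_MEB X (c, r) -> edist q c' <= r' -> edist p c' <= r' ->
  {in X, forall x, edist x c' <= r' \/ edist x q <= eps ^+ 2 * r / 40} ->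
  (1 + eps) * r < edist p c -> (1 + eps ^+ 2 / 16) * r < r'.
Proof.
move=> e0 e1 X0 MX qc' pc' Xc' pc; have [/= r0 _ _] := MX.
rewrite ltNge; apply/negP => h.
pose s := r' + eps ^+ 2 * r / 40.
have r'0 : 0 <= r' by apply: le_trans pc'; exact: edist_ge0.
have er : 0 <= eps ^+ 2 * r by rewrite mulr_ge0 ?sqr_ge0.
have Xs : encloses X (c', s).
  apply/allP => x /Xc' []; rewrite /in_ball/= /s; first by lra.
  by have := edist_triangle q x c'; lra.
have := MEB_sqr_radius_le X0 MX _ Xs; rewrite /s; move=> /(_ ltac:(lra)).
have : edist p c <= edist p c' + edist c c'.
  by rewrite (edistC c) edist_triangle.
set D := edist c c' => pD DD.
(* [D] is at least [edist p c - r'], which exceeds [(eps - eps ^+ 2 / 16) * r]. *)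
have Dlow : eps * r * (15 / 16) < D.
  have : eps ^+ 2 * r <= eps * r by rewrite ler_wpM2r// expr2 ler_piMl// ltW.
  by lra.
have er0 : 0 <= eps * r by rewrite mulr_ge0// ltW.
have D2 : (eps * r * (15 / 16)) ^+ 2 < D ^+ 2.
  by rewrite ltr_pXn2r ?nnegrE ?edist_ge0//; lra.
(* Here 7/80 = 1/16 + 1/40. As [eps ^+ 4 <= eps ^+ 2], squaring yields at most 7/40 + 49/6400 as
   coefficient of [eps ^+ 2 * r ^+ 2], less than the (15/16)^2 from [D2]. *)
have s2 : (r' + eps ^+ 2 * r / 40) ^+ 2
    <= (r * (1 + eps ^+ 2 * (7 / 80))) ^+ 2.
  by rewrite lerXn2r ?nnegrE//; lra.
have e4 : eps ^+ 2 * eps ^+ 2 * r ^+ 2 <= eps ^+ 2 * r ^+ 2.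
  have : eps ^+ 2 <= 1 by rewrite expr_le1// ltW.
  by move=> ?; rewrite ler_wpM2r ?sqr_ge0// ler_piMl ?sqr_ge0.
have : 0 <= eps ^+ 2 * r ^+ 2 by rewrite mulr_ge0 ?sqr_ge0.
by move: DD D2 s2 e4; rewrite !exprMn; lra.
Qed.

End Euclidean.

(** * Counting geometrically decreasing radii *)

Section Counting.
Set Implicit Arguments.
Unset Strict Implicit.
Context {R : realType}.
Implicit Types (q m x eps : R) (s : seq R).

Lemma geometric_path_le q m x s : 0 <= q -> path (fun u v => q * v < u) x s ->
  all (>= m) (x :: s) -> q ^+ size s * m <= x.
Proof.
move=> q0; elim: s x => [|y s IHs] x /=; first by rewrite andbT mul1r.
move=> /andP[qyx ys] /andP[_ yms]; apply: le_trans (ltW qyx).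
by rewrite exprS -mulrA ler_wpM2l// IHs.
Qed.

(** This is [ln (1 + y) <= y] at [y = - (x / (1 + x))], where [1 + y] is the inverse of [1 + x]. *)
Lemma ln1D_ge x : 0 < 1 + x -> x / (1 + x) <= ln (1 + x).
Proof.
move=> x0; have i0 : 0 < (1 + x)^-1 by rewrite invr_gt0.
have E : 1 + - (x / (1 + x)) = (1 + x)^-1 by field; rewrite gt_eqF.
have := @le_ln1Dx R (- (x / (1 + x))); rewrite E lnV ?posrE//; lra.
Qed.

(** With [k] the size of [s] and [q = 1 + eps ^+ 2 / 16], the two bounds on the radii give
    [q ^+ k <= 80 / eps ^+ 2]; logarithms then bound [k]. The summand 1 in the constant counts [x]
    itself. *)
Lemma radii_count eps x s : 0 < eps -> eps <= 1 -> 0 <= x ->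
  path (fun u v => (1 + eps ^+ 2 / 16) * v < u) x s ->
  all (fun v => eps ^+ 2 * x / 80 <= v) s ->
  (size s).+1%:R <= (1 + 32 * (ln 80 + 2)) * (eps ^- 2 * Num.max 1 (ln eps^-1)).
Proof.
move=> e0 e1 x0 qs ms.
set M := Num.max _ _.
have M1 : 1 <= M by rewrite le_max lexx.
have ML : ln eps^-1 <= M by rewrite le_max lexx orbT.
have e20 : 0 < eps ^+ 2 by rewrite exprn_gt0.
have e21 : eps ^+ 2 <= 1 by rewrite expr_le1// ltW.
have E1 : 1 <= eps ^- 2 by rewrite invf_ge1.
have EM : 1 <= eps ^- 2 * M by rewrite mulr_ege1.
have l80 : 0 <= ln 80 :> R by apply: ln_ge0; lra.
suff kle : (size s)%:R <= 32 * (ln 80 + 2) * (eps ^- 2 * M).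
  by rewrite -natr1; lra.
(* A zero radius cannot be divided out, but strict decrease then forces [s] to be empty. *)
have [xle0|xgt0] := leP x 0.
  have {xle0 x0}x0 : x = 0 by apply/eqP; rewrite eq_le xle0.
  case: s qs ms => [_ _|y s]; first by rewrite !mulr_ge0//; lra.
  move=> /= /andP[yx _] /andP[]; rewrite x0 mulr0 mul0r => y0 _.
  by move: yx; rewrite x0 ltNge mulr_ge0//; lra.
have /= := geometric_path_le (m := eps ^+ 2 * x / 80) _ qs; rewrite ms andbT.
move=> /(_ ltac:(lra) ltac:(nra)); set k := size s; set q := 1 + _.
have q0 : 0 < q by rewrite /q; lra.
have -> : q ^+ k * (eps ^+ 2 * x / 80) = (q ^+ k * (eps ^+ 2 / 80)) * x by ring.
rewrite ger_pMl// => qk.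
have {}qk : q ^+ k <= 80 * eps^-1 ^+ 2.
  by rewrite exprVn ler_pdivlMr//; lra.
have qk0 : 0 < q ^+ k by rewrite exprn_gt0.
have ei0 : 0 < eps^-1 by rewrite invr_gt0.
have : ln (q ^+ k) <= ln (80 * eps^-1 ^+ 2).
  by rewrite ler_ln// ?posrE ?mulr_gt0 ?exprn_gt0.
rewrite lnM ?posrE ?exprn_gt0// !lnXn// => lnk.
(* [y / (1 + y) >= y / 2] for [y = eps ^+ 2 / 16 <= 1]. *)
have lnq : eps ^+ 2 / 32 <= ln q.
  apply: le_trans (ln1D_ge q0).
  by rewrite ler_pdivlMr//; rewrite /q; nra.
have k0 : 0 <= k%:R :> R by rewrite ler0n.
have : k%:R * (eps ^+ 2 / 32) <= (ln 80 + 2) * M.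
  apply: le_trans (_ : k%:R * ln q <= _); first by rewrite ler_wpM2l.
  rewrite mulr_natl; apply: le_trans lnk _.
  by rewrite mulrDl -[ln _ *+ 2]mulr_natl lerD ?ler_peMr// ler_wpM2l.
move=> h.
have -> : 32 * (ln 80 + 2) * (eps ^- 2 * M) = 32 * ((ln 80 + 2) * M) / eps ^+ 2.
  by ring.
by rewrite ler_pdivlMr//; lra.
Qed.

End Counting.

(** * Invariant, coverage and size of the collection *)

Section GuardedBallCover.
Set Implicit Arguments.
Unset Strict Implicit.
Context {R : realType} {d : nat}.
Implicit Types (eps : R) (p x : 'rV[R]_d) (t u : triple R d)
  (B : seq (triple R d)) (st : gbc_state R d).

(* The points whose minimum enclosing ball is the latest triple need not all
   still be stored, but the lost ones are close to [p1]. *)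
Definition gbc_invariant eps p1 st : Prop :=
  let: (B, Q) := st in
  [/\ Q = p1 :: [seq guard t | t <- B],
      {in B, forall t, edist p1 (center t) <= radius t /\
                       edist (guard t) (center t) <= radius t},
      pairwise (fun t u => (1 + eps ^+ 2 / 16) * radius u < radius t) B &
      if B is t :: B' then
        all (fun u => eps ^+ 2 * radius t / 80 <= radius u) B' /\
        exists X, [/\ X != [::], is_MEB X (center t, radius t) &
          {in X, forall x, x \in Q \/ edist x p1 <= eps ^+ 2 * radius t / 40}]
      else True].

Lemma MEB_rconsP (Q : seq 'rV[R]_d) p c r : MEB (rcons Q p) = (c, r) ->
  is_MEB (rcons Q p) (c, r) /\ {in rcons Q p, forall x, edist x c <= r}.
Proof.
move=> E; have M : is_MEB (rcons Q p) (c, r).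
  by rewrite -E; apply: MEBP; rewrite -size_eq0 size_rcons.
by split=> //; case: M => _ /allP.
Qed.

Lemma gbc_invariant_step eps p1 st p : 0 < eps -> eps <= 1 ->
  gbc_invariant eps p1 st -> gbc_invariant eps p1 (gbc_step eps p1 st p).
Proof.
move=> e0 e1; case: st => B Q [QE ballB decB headB].
rewrite /gbc_step; case: ifPn => [_|pB]; first by split.
case E: (MEB (rcons Q p)) => [c r]; have [MX inX] := MEB_rconsP E.
have p1c : edist p1 c <= r.
  by apply: inX; rewrite QE mem_rcons in_cons mem_head orbT.
have pc : edist p c <= r by apply: inX; rewrite mem_rcons mem_head.
have Rge0 t : t \in B -> 0 <= radius t.
  by move=> /ballB[h _]; apply: le_trans h; exact: edist_ge0.
(* The older radii are below that of the head [t], so only [t] has to be compared with the new ball;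
   [p] escapes its expansion. *)
have decr u : u \in B -> (1 + eps ^+ 2 / 16) * radius u < r.
  case: B QE ballB decB headB pB Rge0 {E} => // t B QE ballB /= /andP[tB _].
  move=> [_ [X [X0 MX' Xnear]]] pB Rge0 uB.
  have tr : (1 + eps ^+ 2 / 16) * radius t < r.
    apply: (MEB_radius_growth e0 e1 X0 MX' p1c pc) => [x /Xnear[xQ|]|].
    - by left; apply: inX; rewrite mem_rcons in_cons xQ orbT.
    - by right.
    - by move: pB; rewrite negb_or -ltNge => /andP[].
  move: uB; rewrite in_cons => /predU1P[->//|uB].
  apply: le_lt_trans tr; apply: ltW; apply: lt_le_trans (allP tB _ uB) _.
  by rewrite ler_peMl ?Rge0 ?mem_head// lerDl divr_ge0 ?sqr_ge0.
split=> //.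
- move=> t; rewrite in_cons => /predU1P[->//|].
  by rewrite mem_filter => /andP[_]; exact: ballB.
- rewrite /= pairwise_filter// andbT; apply/allP => u.
  by rewrite mem_filter => /andP[_]; exact: decr.
split; first by rewrite filter_all.
exists (rcons Q p); split=> //; first by rewrite -size_eq0 size_rcons.
move=> x; rewrite mem_rcons in_cons QE in_cons.
move=> /or3P[/eqP->|/eqP->|/mapP[t tB ->]].
- by left; rewrite !in_cons eqxx orbT.
- by left; rewrite mem_head.
(* The ball of a deleted triple contains both its guard and [p1], so these are at most
   [2 * radius t] apart. *)
have [rt|rt] := leP (eps ^+ 2 * r / 80) (radius t).
  by left; rewrite !in_cons map_f ?orbT// mem_filter rt.
right; have [] := ballB _ tB; have := edist_triangle (center t) (guard t) p1.
by rewrite (edistC (center t)) /radius/=; move: rt; rewrite /radius; lra.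
Qed.

Lemma gbc_invariant_run eps p1 s : 0 < eps -> eps <= 1 ->
  gbc_invariant eps p1 (gbc_run eps p1 s).
Proof.
move=> e0 e1; elim/last_ind: s => [|s p IHs]; first by split.
by rewrite /gbc_run -cats1 foldl_cat; exact: gbc_invariant_step.
Qed.

Lemma covered_gbc_step eps p1 st p x : 0 < eps -> eps <= 1 ->
  gbc_invariant eps p1 st -> covered eps st.1 x \/ x = p ->
  covered eps (gbc_step eps p1 st p).1 x.
Proof.
move=> e0 e1; case: st => B Q [QE ballB _ _] xBp.
rewrite /gbc_step; case: ifPn => [pB|_]; first by case: xBp => // ->.
case E: (MEB (rcons Q p)) => [c r]; have [[/= r0 _ _] inX] := MEB_rconsP E.
have er : eps ^+ 2 * r <= eps * r.
  by rewrite ler_wpM2r// expr2 ler_piMl// ltW.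
have er0 : 0 <= eps * r by rewrite mulr_ge0// ltW.
case: xBp => [/hasP[t tB]|->]; last first.
  apply/orP; left; rewrite /in_expansion/in_ball/=.
  have : edist p c <= r by apply: inX; rewrite mem_rcons mem_head.
  by rewrite /center/radius/=; lra.
rewrite /in_expansion/in_ball => xt.
have [rt|rt] := leP (eps ^+ 2 * r / 80) (radius t).
  apply/orP; right; apply/hasP; exists t => //.
  by rewrite mem_filter rt.
(* Going from [x] via [center t] and [p1] to [c] costs at most
   [(1 + eps) * radius t + radius t + r], and [3 * radius t] is below [eps * r]. *)
apply/orP; left; suff : edist x c <= (1 + eps) * r by [].
have p1c : edist p1 c <= r.
  by apply: inX; rewrite QE mem_rcons in_cons mem_head orbT.
have [p1t _] := ballB _ tB.
have ert : eps * radius t <= radius t.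
  by rewrite ler_piMl// (le_trans _ p1t)// edist_ge0.
have := edist_triangle (center t) x c; have := edist_triangle p1 (center t) c.
by rewrite (edistC (center t) p1); lra.
Qed.

(** The point [p1] is never processed, but every maintained ball contains it; a nonempty [s] ensures
    that there is such a ball. *)
Lemma covered_gbc_run eps p1 s x : 0 < eps -> eps <= 1 -> s != [::] ->
  x \in p1 :: s -> covered eps (gbc_run eps p1 s).1 x.
Proof.
move=> e0 e1 s0.
have covs y : y \in s -> covered eps (gbc_run eps p1 s).1 y.
  elim/last_ind: s {s0} => // s p IHs ys.
  rewrite /gbc_run -cats1 foldl_cat; apply: covered_gbc_step => //.
    exact: gbc_invariant_run.
  by move: ys; rewrite mem_rcons in_cons => /predU1P[->|/IHs]; [right|left].
rewrite in_cons => /predU1P[->|]; last exact: covs.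
case: s s0 covs => // p s _ /(_ p (mem_head _ _)) /hasP[t tB _].
have := gbc_invariant_run p1 (p :: s) e0 e1.
case: gbc_run tB => B Q /= tB [_ /(_ t tB)[p1t _] _ _].
apply/hasP; exists t => //; rewrite /in_expansion/in_ball.
have : 0 <= eps * radius t.
  by rewrite mulr_ge0 ?(ltW e0)// (le_trans _ p1t)// edist_ge0.
lra.
Qed.

Lemma size_gbc_triples eps p1 s : 0 < eps -> eps <= 1 ->
  (size (gbc_triples eps p1 s))%:R <=
    (1 + 32 * (ln 80 + 2)) * (eps ^- 2 * Num.max 1 (ln eps^-1)).
Proof.
move=> e0 e1; have := gbc_invariant_run p1 s e0 e1.
rewrite /gbc_triples; case: gbc_run => -[|t B] Q [_ ballB decB headB] /=.
  rewrite !mulr_ge0// ?invr_ge0 ?sqr_ge0 ?le_max ?ler01//.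
  by have : 0 <= ln 80 :> R by [apply: ln_ge0; lra]; lra.
case: headB => lowB _; rewrite -(size_map (@radius R d) B).
apply: (radii_count (x := radius t)) => //.
- by have [h _] := ballB t (mem_head _ _); apply: le_trans h; exact: edist_ge0.
- by rewrite path_map; exact: (pairwise_sorted decB).
- by rewrite all_map.
Qed.

End GuardedBallCover.

(** The maximum with 1 is there because the logarithm vanishes at [eps = 1]. Coverage starts at
    [n = 1], since the collection is empty while only [p1] has arrived. *)
Theorem theorem5 (R : realType) :
  exists C : R,
    forall (d : nat) (eps : R) (p1 : 'rV[R]_d) (s : seq 'rV[R]_d) (n : nat),
      0 < eps -> eps <= 1 -> (n <= size s)%N ->
      (size (gbc_triples eps p1 (take n s)))%:R
        <= C * (eps ^- 2 * Num.max 1 (ln eps^-1)) /\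
      ((0 < n)%N ->
        forall x : 'rV[R]_d, x \in p1 :: take n s ->
          exists2 t : triple R d, t \in gbc_triples eps p1 (take n s) &
            edist x (center t) <= (1 + eps) * radius t).
Proof.
exists (1 + 32 * (ln 80 + 2)) => d eps p1 s n e0 e1 ns; split.
  exact: size_gbc_triples.
move=> n0 x xs.
have s0 : take n s != [::] by rewrite -size_eq0 size_takel// -lt0n.
by have /hasP[t] := covered_gbc_run e0 e1 s0 xs; exists t.
Qed.
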